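(* Let $A$ be a complete model and $B,C$ models such that $A$ and $B$ are strongly equivalent and $B\subsetneq C$. Then $C\succ A$, i.e. $C\succsim A$ and not $A\succsim C$.
   Context: A model of computation over a set $X$ is any set of functions $f:X\to X\cup\{\bot\}$, where $\bot$ denotes ''undefined''; $B\subsetneq C$ entails that $B$ and $C$ are over the same set. Injections are extended by $\rho(\bot)=\bot$. $A\succsim_\rho B$ means: for every $g\in B$ there is $f\in A$ with $\rho\circ g=f\circ\rho$; $A\succsim B$ means $A\succsim_\rho B$ for some injection $\rho$. $A$ and $B$ are strongly equivalent if there are bijections $\pi,\tau$ with $A\succsim_\pi B$ and $B\succsim_\tau A$. A model $A$ is complete if for every model $M$ over $\mathrm{dom}\,A$ with $M\supseteq A$ and $A\succsim M$, we have $M=A$. *)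

(* Defs.v *)
From mathcomp Require Import all_boot.
From mathcomp Require Import boolp classical_sets.

Set Implicit Arguments.
Unset Strict Implicit.
Unset Printing Implicit Defensive.

Local Open Scope classical_set_scope.

(* [None] plays the role of the undefined value. *)
Definition model (X : Type) : Type := set (X -> option X).

(* [omap rho] is the extension of rho that sends undefined to undefined. *)
Definition simulates_via (X Y : Type) (rho : Y -> X)
    (A : model X) (B : model Y) : Prop :=
  forall g, B g -> exists2 f, A f & omap rho \o g = f \o rho.

Definition at_least_as_powerful (X Y : Type) (A : model X) (B : model Y) : Prop :=
  exists2 rho : Y -> X, injective rho & simulates_via rho A B.

Definition more_powerful (X Y : Type) (A : model X) (B : model Y) : Prop :=
  at_least_as_powerful A B /\ ~ at_least_as_powerful B A.

Definition strongly_equivalent (X Y : Type) (A : model X) (B : model Y) : Prop :=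
  (exists2 pi : Y -> X, bijective pi & simulates_via pi A B) /\
  (exists2 tau : X -> Y, bijective tau & simulates_via tau B A).

Definition complete_model (X : Type) (A : model X) : Prop :=
  forall M : model X, A `<=` M -> at_least_as_powerful A M -> M = A.

(* Main.v *)
Require Import Defs.
From mathcomp Require Import all_boot.
From mathcomp Require Import boolp classical_sets.
Local Open Scope classical_set_scope.

(** Let [tau] be the bijection through which [B] simulates [A].  Conjugating
    [C] by [tau] gives a model over the domain of [A] that contains [A], and
    strictly so because [B] is strictly inside [C].  A simulation of [C] by [A]
    via [rho] becomes a simulation of this conjugate via [rho \o tau], which
    contradicts completeness. *)

Lemma simulates_via_subset {X Y : Type} {rho : Y -> X} {A A' : model X}
    {B : model Y} :
  A `<=` A' -> simulates_via rho A B -> simulates_via rho A' B.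
Proof. by move=> AA' AB g /AB[f /AA' A'f fE]; exists f. Qed.

Lemma simulates_via_comp {X Y Z : Type} {rho : Y -> X} {sigma : Z -> Y}
    {A : model X} {B : model Y} {D : model Z} :
  simulates_via rho A B -> simulates_via sigma B D ->
  simulates_via (rho \o sigma) A D.
Proof.
move=> AB BD h /BD[g /AB[f Af fE] gE]; exists f => //; apply/funext => z /=.
rewrite -[f _]/((f \o rho) (sigma z)) -fE /= -[g _]/((g \o sigma) z) -gE /=.
by case: (h z).
Qed.

(** The inverse is a separate argument, so each lemma can assume just the cancellation law it
    needs. *)
Definition conjugate_fun {X Y : Type} (tau : X -> Y) (tau' : Y -> X)
    (g : Y -> option Y) : X -> option X := omap tau' \o g \o tau.

Lemma conjugate_funE {X Y : Type} (tau : X -> Y) (tau' : Y -> X)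
    (g : Y -> option Y) :
  cancel tau' tau -> omap tau \o conjugate_fun tau tau' g = g \o tau.
Proof.
move=> tauK; apply/funext => x; rewrite /conjugate_fun /=.
by case: (g _) => //= y; rewrite tauK.
Qed.

Lemma simulates_via_conjugate {X Y : Type} (tau : X -> Y) (tau' : Y -> X)
    (C : model Y) :
  cancel tau' tau -> simulates_via tau C (conjugate_fun tau tau' @` C).
Proof. by move=> tauK _ [g Cg <-]; exists g; rewrite ?conjugate_funE. Qed.

(** If [g] simulates [f], then [g \o tau = omap tau \o f], and applying [omap tau'] recovers [f]. *)
Lemma simulates_via_sub_conjugate {X Y : Type} (tau : X -> Y) (tau' : Y -> X)
    (A : model X) (B : model Y) :
  cancel tau tau' -> simulates_via tau B A ->
  A `<=` conjugate_fun tau tau' @` B.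
Proof.
move=> tauK BA f /BA[g Bg gE]; exists g => //; apply/funext => x.
rewrite /conjugate_fun /= -[g _]/((g \o tau) x) -gE /=.
by case: (f x) => //= y; rewrite tauK.
Qed.

Theorem mainTheorem18 (X Y : Type) (A : model X) (B C : model Y) :
  complete_model A -> strongly_equivalent A B -> B `<` C ->
  more_powerful C A.
Proof.
move=> Acomplete [_ [tau tau_bij BA]] [BC nCB].
have CA := simulates_via_subset BC BA.
split; first by exists tau => //; exact: bij_inj.
(* Strictness is refuted by placing every [g] of [C] in [B]. *)
move=> [rho rho_inj AC]; apply: nCB => g Cg.
have [tau' tauK tau'K] := tau_bij.
have conjA : conjugate_fun tau tau' @` C = A.
  apply: Acomplete; first exact: simulates_via_sub_conjugate.
  exists (rho \o tau); first by apply: inj_comp => //; exact: bij_inj.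
  exact/(simulates_via_comp AC)/simulates_via_conjugate.
(* Both [g] and some [h] in [B] simulate the conjugate of [g] via [tau], so they agree on the image
   of [tau], which is all of [Y]. *)
have /BA[h Bh] : A (conjugate_fun tau tau' g) by rewrite -conjA; exists g.
rewrite conjugate_funE// => ghE; suff -> : g = h by [].
by apply/funext => y; rewrite -[y]tau'K; exact: (congr1 (@^~ (tau' y)) ghE).
Qed.
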